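(* Let $\mathcal G_1$ and $\mathcal G_2$ be monotone graph classes each containing $K_2$. Then $\mathcal G_1\times\mathcal G_2$ has bounded pathwidth if and only if $\mathcal G_1$ and $\mathcal G_2$ both have bounded pathwidth and at least one of the following holds: (i) $\tilde{\mathsf v}(\mathcal G_1)$ or $\tilde{\mathsf v}(\mathcal G_2)$ is bounded; (ii) $\tilde\tau(\mathcal G_1)$ and $\Delta(\mathcal G_2)$ are bounded; (iii) $\tilde\tau(\mathcal G_2)$ and $\Delta(\mathcal G_1)$ are bounded.
   Context: A graph class is a set of graphs closed under isomorphism containing a graph with non-empty vertex set; it is monotone if closed under subgraphs. For a graph parameter $\beta$, $\beta(\mathcal G):=\sup\{\beta(G):G\in\mathcal G\}$, bounded if finite. $\Delta$ is maximum degree, $\tilde{\mathsf v}(G)$ is the maximum number of vertices of a connected component of $G$, and $\tilde\tau(G)$ is the maximum vertex cover number of a connected component of $G$ (the vertex cover number of a graph is the minimum size of a vertex set whose complement is independent). $\mathcal G_1\times\mathcal G_2:=\{G_1\times G_2:G_i\in\mathcal G_i\}$, where the direct product $G_1 \times G_2$ has vertex set $V(G_1)\times V(G_2)$ and $(a,v)(b,u)$ is an edge iff $ab\in E(G_1)$ and $uv\in E(G_2)$. *)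

(* Defs.v *)
From mathcomp Require Import all_boot.
Set Implicit Arguments. Unset Strict Implicit. Unset Printing Implicit Defensive.

Record sgraph := SGraph {
  svert :> finType;
  sadj : rel svert;
  sadj_sym : symmetric sadj;
  sadj_irr : irreflexive sadj }.
Arguments sadj s : clear implicits.

Definition giso (G H : sgraph) : Prop :=
  exists f : G -> H, bijective f /\ forall x y, sadj H (f x) (f y) = sadj G x y.

Definition gsub (H G : sgraph) : Prop :=
  exists f : H -> G, injective f /\ forall x y, sadj H x y -> sadj G (f x) (f y).

Definition graph_class (C : sgraph -> Prop) : Prop :=
  (forall G H, C G -> giso G H -> C H) /\ (exists G, C G /\ 0 < #|G|).

Definition monotone (C : sgraph -> Prop) : Prop :=
  forall G H, C G -> gsub H G -> C H.

Definition K2adj : rel bool := fun x y => x != y.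
Lemma K2_sym : symmetric K2adj. Proof. by move=> x y; rewrite /K2adj eq_sym. Qed.
Lemma K2_irr : irreflexive K2adj. Proof. by move=> x; rewrite /K2adj eqxx. Qed.
Definition K2 : sgraph := SGraph K2_sym K2_irr.

Definition dprod_adj (G1 G2 : sgraph) : rel (G1 * G2)%type :=
  fun p q => sadj G1 p.1 q.1 && sadj G2 p.2 q.2.
Lemma dprod_sym G1 G2 : symmetric (@dprod_adj G1 G2).
Proof. by move=> p q; rewrite /dprod_adj sadj_sym [sadj G2 _ _]sadj_sym. Qed.
Lemma dprod_irr G1 G2 : irreflexive (@dprod_adj G1 G2).
Proof. by move=> p; rewrite /dprod_adj sadj_irr. Qed.
Definition gdprod (G1 G2 : sgraph) : sgraph := SGraph (@dprod_sym G1 G2) (@dprod_irr G1 G2).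

Definition class_dprod (C1 C2 : sgraph -> Prop) : sgraph -> Prop :=
  fun H => exists G1 G2, C1 G1 /\ C2 G2 /\ H = gdprod G1 G2.

Definition path_decomposition (G : sgraph) (B : seq {set G}) : Prop :=
  [/\ forall v : G, exists2 i, i < size B & v \in nth set0 B i,
      forall x y : G, sadj G x y ->
        exists2 i, i < size B & (x \in nth set0 B i) && (y \in nth set0 B i)
    & forall (v : G) i j k, i <= j -> j <= k -> k < size B ->
        v \in nth set0 B i -> v \in nth set0 B k -> v \in nth set0 B j].

Definition pw_le (G : sgraph) (k : nat) : Prop :=
  exists B : seq {set G}, path_decomposition B /\
    forall i, i < size B -> #|nth set0 B i| <= k.+1.

Definition maxdeg_le (G : sgraph) (k : nat) : Prop :=
  forall v : G, #|[set u | sadj G v u]| <= k.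

Definition compsize_le (G : sgraph) (k : nat) : Prop :=
  forall v : G, #|[set u | connect (sadj G) v u]| <= k.

Definition compvc_le (G : sgraph) (k : nat) : Prop :=
  forall v : G, exists S : {set G},
    [/\ S \subset [set u | connect (sadj G) v u], #|S| <= k &
        forall x y : G, connect (sadj G) v x -> connect (sadj G) v y ->
          sadj G x y -> (x \in S) || (y \in S)].

(* a graph parameter, given by its "<= k" predicate, is bounded on a class *)
Definition bounded (le : sgraph -> nat -> Prop) (C : sgraph -> Prop) : Prop :=
  exists k, forall G, C G -> le G k.

(* Main.v *)
Require Import Defs.
From mathcomp Require Import all_boot zify.
From Stdlib Require Import Classical.

Set Implicit Arguments.
Unset Strict Implicit.
Unset Printing Implicit Defensive.

(** Pathwidth is handled through representations of the vertices by intervals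
    of natural numbers.

    If [G * K2] is represented, the interval from the larger left end to the
    larger right end of the two lifts of [v] represents [v], so the pathwidth
    of [G] is at most that of [G * K2].

    The remaining lower bounds come from two families of [n] disjoint walks,
    each walk of one touching each walk of the other: by the Helly property
    some bag meets all members of one of the families.  Such families exist in
    star * star, path * path and spider * path, a spider being a star whose
    edges are subdivided once.  Hence in a product of bounded pathwidth, stars
    are bounded in one factor, paths in one factor, and spiders are bounded in
    any factor whose partner has long paths.  Without long paths, bounded
    degree bounds the components, and bounded spiders bound the vertex covers
    of the components.

    Conversely, let [(B_i)] be a path decomposition of [G2] and [D] a component
    of [G1].  If [D] is bounded, use the bags [D * B_i].  If [D] has a bounded
    vertex cover [S] and [G2] has bounded degree, use the bags [S * N[B_i]],
    each repeated with one additional vertex outside [S * V(G2)]. *)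

(** * Interval representations and pathwidth *)

(** [k] bounds the bag size, that is, pathwidth plus one. As [sadj] is symmetric, the one-sided edge
    condition makes the intervals of adjacent vertices meet. *)
Definition interval_rep (G : sgraph) (l r : G -> nat) (k : nat) : Prop :=
  [/\ forall v, l v <= r v,
      forall x y, sadj G x y -> l x <= r y
    & forall t, #|[set v | l v <= t <= r v]| <= k].

(** The interval of a vertex runs from its first to its last bag; conversely bag [t] holds the
    vertices alive at [t]. *)
Lemma pw_interval_rep (G : sgraph) k :
  pw_le G k <-> exists l r : G -> nat, interval_rep l r k.+1.
Proof.
split=> [[B [[cov edge conv] width]]|[l [r [lr edge width]]]].
  pose l v := find (fun A : {set G} => v \in A) B.
  pose r v := \max_(i < size B | v \in nth set0 B i) i.
  have lP v i : i < size B -> v \in nth set0 B i -> l v <= i.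
    by move=> _ vi; rewrite leqNgt; apply/negP => /(before_find set0); rewrite vi.
  have rP v i : i < size B -> v \in nth set0 B i -> i <= r v.
    by move=> iB vi; apply: (@leq_bigmax_cond _ _ (fun j : 'I_(size B) => nat_of_ord j) (Ordinal iB)).
  have lin v : v \in nth set0 B (l v).
    have [i iB vi] := cov v; apply: (@nth_find _ set0 (fun A : {set G} => v \in A)).
    by apply/(has_nthP set0); exists i.
  have rin v : r v < size B /\ v \in nth set0 B (r v).
    have [i iB vi] := cov v.
    have c0 : 0 < #|[pred i : 'I_(size B) | v \in nth set0 B i]|.
      by apply/card_gt0P; exists (Ordinal iB).
    have [j vj Ej] := eq_bigmax_cond (fun j : 'I_(size B) => nat_of_ord j) c0.
    by have -> : r v = j by rewrite -Ej; apply: eq_bigl.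
  exists l, r; split=> [v|x y /edge[i iB /andP[xi yi]]|t].
  - by have [i iB vi] := cov v; apply: leq_trans (lP _ _ iB vi) (rP _ _ iB vi).
  - exact: leq_trans (lP _ _ iB xi) (rP _ _ iB yi).
  have [tB|Bt] := ltnP t (size B); last first.
    apply: leq_trans (leq0n _); rewrite leqn0 cards_eq0; apply/eqP/setP => v.
    rewrite !inE; apply/negP => /andP[_ tr].
    by have [rB _] := rin v; have := leq_ltn_trans tr rB; rewrite ltnNge Bt.
  apply: leq_trans (width t tB); apply/subset_leq_card/subsetP => v.
  rewrite inE => /andP[lt tr]; have [rB vr] := rin v.
  exact: conv lt tr rB (lin v) vr.
pose M := (\max_v r v).+1.
have rM v : r v < M by rewrite ltnS leq_bigmax.
pose B := mkseq (fun t => [set v | l v <= t <= r v]) M.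
have nthB t : t < M -> nth set0 B t = [set v | l v <= t <= r v].
  by move=> tM; rewrite nth_mkseq.
exists B; rewrite /path_decomposition size_mkseq; split; last first.
  by move=> t tM; rewrite nthB.
split=> [v|x y xy|v i j m ij jm mM].
- by exists (r v); rewrite ?nthB ?inE ?lr ?leqnn.
- have yx : sadj G y x by rewrite sadj_sym.
  have tM : maxn (l x) (l y) < M.
    by rewrite gtn_max !(leq_ltn_trans (lr _) (rM _)).
  exists (maxn (l x) (l y)) => //; rewrite nthB // !inE !geq_max !leq_max !leqnn.
  by rewrite !lr !edge ?orbT.
rewrite !nthB ?inE ?(leq_ltn_trans jm) ?(leq_ltn_trans ij) ?(leq_ltn_trans jm) //.
by move=> /andP[li _] /andP[_ mr]; rewrite (leq_trans li ij) (leq_trans jm mr).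
Qed.

(** * Subgraphs, double covers and disjoint unions *)

Lemma gsub_pw_le (G H : sgraph) k : gsub H G -> pw_le G k -> pw_le H k.
Proof.
move=> [f [fI fE]] /pw_interval_rep[l [r [lr edge width]]].
apply/pw_interval_rep; exists (l \o f), (r \o f); split=> [v|x y xy|t] /=.
- exact: lr.
- exact/edge/fE.
apply: leq_trans (width t); rewrite -(card_imset _ fI).
by apply/subset_leq_card/subsetP => _ /imsetP[x + ->]; rewrite !inE.
Qed.

Lemma dprod_swap (G H : sgraph) : gsub (gdprod H G) (gdprod G H).
Proof.
exists (fun p => (p.2, p.1)); split=> [[a b] [c d] [-> ->] //|x y].
by rewrite /= /dprod_adj /= andbC.
Qed.

(** At any time in the new interval both lifts of [v] have started and one has not ended, so a lift
    of [v] is alive. *)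
Lemma pw_le_double_cover (G : sgraph) k : pw_le (gdprod G K2) k -> pw_le G k.
Proof.
move=> /pw_interval_rep[l [r [lr edge width]]]; apply/pw_interval_rep.
exists (fun v => maxn (l (v, true)) (l (v, false))).
exists (fun v => maxn (r (v, true)) (r (v, false))); split=> [v|x y xy|t].
- by have := lr (v, true); have := lr (v, false); lia.
- have e b : l (x, b) <= r (y, ~~ b).
    by apply: edge; rewrite /= /dprod_adj /= xy; case: b.
  by have := e true; have := e false => /=; lia.
apply: leq_trans (width t).
set A := [set v | _]; set B := [set v | _].
apply: leq_trans (leq_imset_card fst B); apply/subset_leq_card/subsetP => v.
rewrite inE geq_max leq_max => /andP[/andP[lt lf] /orP[rt|rf]]; apply/imsetP.
  by exists (v, true); rewrite // inE lt.
by exists (v, false); rewrite // inE lf.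
Qed.

(** Fibres are unions of components. The shift [s] places their representations in disjoint windows
    of length [M], so [t %/ M] determines the fibre alive at [t]. *)
Lemma pw_le_fibers (G : sgraph) (T : finType) (f : G -> T) k :
  (forall x y, sadj G x y -> f x = f y) ->
  (forall c, exists l r : G -> nat,
     [/\ forall v, f v = c -> l v <= r v,
         forall x y, f x = c -> f y = c -> sadj G x y -> l x <= r y
       & forall t, #|[set v | (f v == c) && (l v <= t <= r v)]| <= k.+1]) ->
  pw_le G k.
Proof.
move=> fE /fin_all_exists[l /fin_all_exists[r rep]]; apply/pw_interval_rep.
pose M := (\max_c \max_v r c v).+1.
have rM c v : r c v < M.
  by rewrite ltnS; apply: leq_trans (leq_bigmax c); apply: (leq_bigmax v).
pose s v := enum_rank (f v) * M.
have sE x y : f x = f y -> s x = s y by rewrite /s => ->.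
exists (fun v => s v + l (f v) v), (fun v => s v + r (f v) v); split=> [v|x y xy|t].
- by rewrite leq_add2l; have [-> //] := rep (f v).
- have fxy := fE _ _ xy; have [_ edge _] := rep (f x).
  by rewrite (sE _ _ fxy) leq_add2l -fxy edge.
set A := [set v | _].
have [->|[x xA]] := set_0Vmem A; first by rewrite cards0.
have inA v : v \in A -> t %/ M = enum_rank (f v).
  rewrite inE => /andP[lo hi]; have := rM (f v) v; move: lo hi; rewrite /s.
  set q := nat_of_ord _ => lo hi rv.
  have -> : t = q * M + (t - q * M) by lia.
  rewrite divnMDl // divn_small ?addn0 //; lia.
have [_ _ width] := rep (f x).
apply: leq_trans (width (t - s x)); apply/subset_leq_card/subsetP => v vA.
have fvx : f v = f x by apply/enum_rank_inj/val_inj; rewrite /= -inA // -inA.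
move: vA; rewrite !inE fvx eqxx /= (sE _ _ fvx).
by move=> /andP[lo hi]; lia.
Qed.

(** * Component size from degree and path length *)

Lemma card_bigcup_le (I T : finType) (A : {set I}) (F : I -> {set T}) m :
  (forall i, i \in A -> #|F i| <= m) -> #|\bigcup_(i in A) F i| <= #|A| * m.
Proof.
move=> Fm; rewrite -sum_nat_const.
elim/big_rec2: _ => [|i n B iA Bn]; first by rewrite cards0.
by apply: leq_trans (leq_card_setU _ _) _; apply: leq_add Bn; apply: Fm.
Qed.

Definition cnbhd (G : sgraph) (A : {set G}) : {set G} :=
  [set v | [exists u in A, (u == v) || sadj G u v]].

Lemma card_cnbhd (G : sgraph) (A : {set G}) d :
  maxdeg_le G d -> #|cnbhd A| <= #|A| * d.+1.
Proof.
move=> deg.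
have -> : cnbhd A = \bigcup_(u in A) (u |: [set v | sadj G u v]).
  apply/setP=> v; rewrite inE; apply/exists_inP/bigcupP => -[u uA];
  by rewrite ?inE => uv; exists u; rewrite ?inE // eq_sym.
by apply: card_bigcup_le => u _; rewrite cardsU1 -add1n leq_add ?leq_b1.
Qed.

Definition no_path (G : sgraph) (n : nat) : Prop :=
  forall s : seq G, uniq s -> sorted (sadj G) s -> size s < n.

Lemma sadj_connect_sym (G : sgraph) : connect_sym (sadj G).
Proof. exact/sym_connect_sym/sadj_sym. Qed.

(** Simple paths from [v] have fewer than [n] edges, so the component lies in the ball of radius
    [n]; each unit of radius multiplies the size by at most [d.+1]. *)
Lemma compsize_bound (G : sgraph) d n :
  maxdeg_le G d -> no_path G n -> compsize_le G (d.+1 ^ n).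
Proof.
move=> deg nop v.
pose ball m := iter m (@cnbhd G) [set v].
have cball m : #|ball m| <= d.+1 ^ m.
  elim: m => [|m IH]; first by rewrite cards1.
  by rewrite expnSr; apply: leq_trans (card_cnbhd _ deg) _; rewrite leq_mul2r IH orbT.
have ballS m u w : u \in ball m -> (u == w) || sadj G u w -> w \in ball m.+1.
  by move=> um uw; rewrite /ball iterS inE; apply/exists_inP; exists u.
apply: leq_trans (cball n); apply/subset_leq_card/subsetP => u.
rewrite inE => /connectP[p vp ->]; case/shortenP: vp => {}p vp up _.
have szp : size p <= n by apply: ltnW; apply: ltnW; exact: (nop (v :: p)).
have last_ball q : path (sadj G) v q -> last v q \in ball (size q).
  elim/last_ind: q => [|q x IH]; first by rewrite inE.
  rewrite rcons_path last_rcons size_rcons => /andP[/IH vq qx].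
  by apply: ballS vq _; rewrite qx orbT.
rewrite -(subnK szp); elim: (n - size p) => [|m IH]; first exact: last_ball.
by apply: ballS IH _; rewrite eqxx.
Qed.

(** * Touching families of walks *)

(** A discrete intermediate value argument: if nothing on the walk is alive at [t], each interval
    lies wholly before or wholly after [t], and adjacent vertices lie on the same side. *)
Lemma walk_alive (G : sgraph) (l r : G -> nat) k (s : seq G) x y t :
  interval_rep l r k -> sorted (sadj G) s -> x \in s -> y \in s ->
  l x <= t -> t <= r y -> exists2 z, z \in s & l z <= t <= r z.
Proof.
move=> [lr edge _] ss xs ys lx ry; apply/hasP/negP => /negP; rewrite -all_predC.
move=> /allP dead.
have side z : z \in s -> (t < l z) = ~~ (r z < t).
  by move=> /dead /=; have := lr z; lia.
have constant_side u : u \in s -> (r u < t) = (r (head x s) < t).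
  elim: s ss side u {xs ys dead} => [|a s IH] //= ss side u.
  rewrite inE => /predU1P[-> //|us].
  rewrite (IH (path_sorted ss)) //; last by move=> z zs; apply: side; rewrite inE zs orbT.
  case: s us ss side {IH} => [|b s] //= _ /andP[ab _] side.
  have := edge _ _ ab; rewrite sadj_sym in ab; have := edge _ _ ab.
  have := side a; have := side b; rewrite !inE !eqxx orbT => /(_ isT) + /(_ isT).
  lia.
have := constant_side _ xs; have := constant_side _ ys; have := side _ xs; lia.
Qed.

Lemma alive_family (G : sgraph) (l r : G -> nat) k n (X : 'I_n -> seq G) t :
  interval_rep l r k ->
  (forall i j z, z \in X i -> z \in X j -> i = j) ->
  (forall i, exists2 z, z \in X i & l z <= t <= r z) -> n <= k.
Proof.
move=> [_ _ width] disj alive.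
have /fin_all_exists[z zP] i : exists z, z \in X i /\ l z <= t <= r z.
  by have [z] := alive i; exists z.
apply: leq_trans (width t).
have zI : injective z.
  move=> i j zij; have [zi _] := zP i; have [zj _] := zP j.
  by apply: disj zi _; rewrite zij.
rewrite -{1}(card_ord n) -(card_codom zI); apply/subset_leq_card/subsetP => v.
by move=> /codomP[i ->]; rewrite inE; have [] := zP i.
Qed.

(* At the time when the first member of [X] ends, all of [X] is alive, unless
   some other member starts later; in that case all of [Y] is alive. *)
Lemma touching_families (G : sgraph) (l r : G -> nat) k n (X Y : 'I_n -> seq G) :
  interval_rep l r k ->
  (forall i, sorted (sadj G) (X i)) -> (forall i, sorted (sadj G) (Y i)) ->
  (forall i j z, z \in X i -> z \in X j -> i = j) ->
  (forall i j z, z \in Y i -> z \in Y j -> i = j) ->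
  (forall i j, exists x y,
     [/\ x \in X i, y \in Y j & (x == y) || sadj G x y]) ->
  n <= k.
Proof.
case: n X Y => [|n] // X Y rep sX sY dX dY touch.
have [lr edge _] := rep.
have touchP i j : exists x y, [/\ x \in X i, y \in Y j, l x <= r y & l y <= r x].
  have [x [y [xi yj /orP[/eqP xy|xy]]]] := touch i j; exists x, y; split=> //;
  by rewrite ?xy ?lr // edge // sadj_sym.
pose hi i := \max_(z in X i) r z.
have hiP i z : z \in X i -> r z <= hi i by move=> zi; apply: leq_bigmax_cond.
have hi_in i : exists2 z, z \in X i & r z = hi i.
  have [x [_ [xi _ _ _]]] := touchP i ord0.
  have [|z zi zE] := @eq_bigmax_cond _ [pred z | z \in X i] r.
    by apply/card_gt0P; exists x.
  by exists z; rewrite // -zE; apply: eq_bigl.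
case: (@arg_minnP _ ord0 xpredT hi) => // i1 _ min1; pose t := hi i1.
have [all_alive|] := boolP [forall i, has (fun x => l x <= t) (X i)].
  apply: (alive_family (t := t) rep dX) => i.
  have /hasP[x xi lx] := forallP all_alive i; have [y yi ry] := hi_in i.
  by apply: walk_alive rep (sX i) xi yi lx _; rewrite ry min1.
rewrite negb_forall => /existsP[i2 /hasPn late].
(* Touching [X i1] gives [Y j] a vertex that starts by [t]; touching [X i2], which starts after [t],
   gives it one that ends after [t]. *)
apply: (alive_family (t := t) rep dY) => j.
have [x [y [xi yj _ lyx]]] := touchP i1 j.
have [x' [y' [xi' yj' lxy _]]] := touchP i2 j.
apply: walk_alive rep (sY j) yj yj' (leq_trans lyx (hiP _ _ xi)) _.
by have := late _ xi'; rewrite -ltnNge => tx; apply: leq_trans lxy; apply: ltnW.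
Qed.

(** * Lower bounds from stars, paths and spiders *)

Lemma sorted_mkseq (T : Type) (e : rel T) (f : nat -> T) n :
  (forall i, i.+1 < n -> e (f i) (f i.+1)) -> sorted e (mkseq f n).
Proof.
case: n => [|n] // ef; apply/(sortedP (f 0)) => i; rewrite size_mkseq => iN.
by rewrite !nth_mkseq ?(ltnW iN) // ef.
Qed.

Definition has_star (G : sgraph) (n : nat) : Prop :=
  exists c (u : 'I_n -> G), injective u /\ forall i, sadj G c (u i).

Definition has_path (G : sgraph) (n : nat) : Prop :=
  exists p : nat -> G, {in gtn n &, injective p} /\
    forall i, i.+1 < n -> sadj G (p i) (p i.+1).

(** Disjointness concerns only the legs [a i], [b i]; the centre may coincide with one [b i]. *)
Definition has_spider (G : sgraph) (n : nat) : Prop :=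
  exists c (a b : 'I_n -> G),
    [/\ forall i, sadj G c (a i), forall i, sadj G (a i) (b i)
      & forall i j z, z \in [:: a i; b i] -> z \in [:: a j; b j] -> i = j].

Lemma no_star_maxdeg (G : sgraph) n : ~ has_star G n -> maxdeg_le G n.
Proof.
move=> nostar v; rewrite leqNgt; apply/negP => /ltnW deg; case: nostar.
exists v, (fun i => enum_val (widen_ord deg i)); split=> [i j|i].
  by move=> /enum_val_inj/(congr1 val)/= /val_inj.
by have := enum_valP (widen_ord deg i); rewrite inE.
Qed.

Lemma no_has_path (G : sgraph) n : 0 < n -> ~ has_path G n -> no_path G n.
Proof.
move=> n0 nop s us ss; rewrite ltnNge; apply/negP => sn; case: nop.
case: s us ss sn => [|x s] us ss sn; first by rewrite leqNgt n0 in sn.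
exists (nth x (x :: s)); split=> [i j|i iN].
  rewrite !inE => iN jN /eqP; rewrite nth_uniq ?(leq_trans _ sn) //.
  by move=> /eqP.
by apply: (sortedP x ss); apply: leq_trans sn.
Qed.

(** The vertices [(c, u' i)] and [(u j, c')] form the two sides of a complete bipartite subgraph. *)
Lemma star_star (G1 G2 : sgraph) n k :
  has_star G1 n -> has_star G2 n -> pw_le (gdprod G1 G2) k -> n <= k.+1.
Proof.
move=> [c [u [uI cu]]] [c' [u' [uI' cu']]] /pw_interval_rep[l [r rep]].
pose X (i : 'I_n) : seq (gdprod G1 G2) := [:: (c, u' i)].
pose Y (i : 'I_n) : seq (gdprod G1 G2) := [:: (u i, c')].
apply: (touching_families (X := X) (Y := Y) rep) => // [i j z|i j z|i j].
- by rewrite !inE => /eqP-> /eqP[/uI'].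
- by rewrite !inE => /eqP-> /eqP[/uI].
exists (c, u' i), (u j, c'); rewrite !inE; split=> //.
by rewrite /= /dprod_adj /= cu sadj_sym cu' orbT.
Qed.

(** [X i] runs along [p] while alternating between [q i.*2] and [q i.*2.+1], and [Y j] does the same
    with the factors exchanged. They meet in [(p j.*2, q i.*2)]. *)
Lemma path_path (G1 G2 : sgraph) n k :
  has_path G1 n.*2 -> has_path G2 n.*2 -> pw_le (gdprod G1 G2) k -> n <= k.+1.
Proof.
move=> [p [pI pE]] [q [qI qE]] /pw_interval_rep[l [r rep]].
pose X (i : 'I_n) : seq (gdprod G1 G2) :=
  mkseq (fun s => (p s, q (i.*2 + odd s))) n.*2.
pose Y (i : 'I_n) : seq (gdprod G1 G2) :=
  mkseq (fun s => (p (i.*2 + odd s), q s)) n.*2.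
have lt2 (i : 'I_n) (b : bool) : i.*2 + b < n.*2.
  by have := ltn_ord i; case: b => /=; lia.
have inj2 (i j : 'I_n) (b c : bool) : i.*2 + b = j.*2 + c -> i = j.
  by move=> e; apply: val_inj => /=; case: b c e => [] [] /=; lia.
apply: (touching_families (X := X) (Y := Y) rep) => [i|i|i j z|i j z|i j].
- apply: sorted_mkseq => s sn; rewrite /= /dprod_adj /= pE //=.
  case: (odd s) => /=; rewrite addn0 addn1.
    by rewrite sadj_sym qE // -addn1 (lt2 i true).
  by rewrite qE // -addn1 (lt2 i true).
- apply: sorted_mkseq => s sn; rewrite /= /dprod_adj /= qE //= andbT.
  case: (odd s) => /=; rewrite addn0 addn1.
    by rewrite sadj_sym pE // -addn1 (lt2 i true).
  by rewrite pE // -addn1 (lt2 i true).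
- move=> /mapP[s _ ->] /mapP[t _ [_ /qI]].
  by rewrite !inE !lt2 => /(_ isT isT)/inj2.
- move=> /mapP[s _ ->] /mapP[t _ [/pI + _]].
  by rewrite !inE !lt2 => /(_ isT isT)/inj2.
exists (p j.*2, q i.*2), (p j.*2, q i.*2); rewrite eqxx; split=> //.
  by apply/mapP; exists j.*2; rewrite ?mem_iota ?odd_double ?addn0 //= ltn_double.
by apply/mapP; exists i.*2; rewrite ?mem_iota ?odd_double ?addn0 //= ltn_double.
Qed.

(** [X i] runs along [q] while alternating on leg [i]. At even times it is at [a i], hence at time
    [j.*2] adjacent to [(c, q j.*2.+1)]. *)
Lemma spider_path (G1 G2 : sgraph) n k :
  has_spider G1 n -> has_path G2 n.*2 -> pw_le (gdprod G1 G2) k -> n <= k.+1.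
Proof.
move=> [c [a [b [ca ab disj]]]] [q [qI qE]] /pw_interval_rep[l [r rep]].
pose X (i : 'I_n) : seq (gdprod G1 G2) :=
  mkseq (fun s => (if odd s then b i else a i, q s)) n.*2.
pose Y (i : 'I_n) : seq (gdprod G1 G2) :=
  [:: (c, q i.*2.+1)].
have lt2 (i : 'I_n) : i.*2.+1 < n.*2 by have := ltn_ord i; lia.
apply: (touching_families (X := X) (Y := Y) rep) => [i|//|i j z|i j z|i j].
- apply: sorted_mkseq => s sn; rewrite /= /dprod_adj /= qE //= andbT.
  by case: (odd s); rewrite //= sadj_sym.
- move=> /mapP[s _ ->] /mapP[t _ [e _]].
  apply: (disj i j (if odd s then b i else a i)); last rewrite e;
  by rewrite !inE; case: odd; rewrite eqxx ?orbT.
- rewrite !inE => /eqP-> /eqP[/qI]; rewrite !inE !lt2 => /(_ isT isT) e.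
  by apply: val_inj => /=; lia.
exists (a i, q j.*2), (c, q j.*2.+1); rewrite !inE; split=> //.
  apply/mapP; exists j.*2; rewrite ?odd_double //.
  by rewrite mem_iota /= ltn_double.
by rewrite /= /dprod_adj /= sadj_sym ca qE ?orbT.
Qed.

(** * Vertex covers of components without large spiders *)

(** A relation on [G] itself keeps the vertex type fixed while vertices are deleted in the
    induction. *)
Definition induced (G : sgraph) (A : {set G}) : rel G :=
  fun x y => [&& x \in A, y \in A & sadj G x y].

Lemma induced_sym (G : sgraph) (A : {set G}) : symmetric (induced A).
Proof. by move=> x y; rewrite /induced sadj_sym andbCA. Qed.

Lemma path_induced_sub (G : sgraph) (A : {set G}) x p :
  x \in A -> path (induced A) x p -> {subset x :: p <= A}.
Proof.
elim: p x => [|y p IH] x xA /=; first by move=> _ z; rewrite inE => /eqP->.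
move=> /andP[/and3P[_ yA _] yp] z; rewrite inE => /predU1P[->//|].
exact: IH.
Qed.

Lemma path_induced_setD1 (G : sgraph) (A : {set G}) c x p :
  x != c -> c \notin p -> path (induced A) x p -> path (induced (A :\ c)) x p.
Proof.
elim: p x => [|y p IH] x //= xc; rewrite inE negb_or => /andP[cy cp].
move=> /andP[/and3P[xA yA xy] yp]; rewrite IH // 1?eq_sym // andbT.
by rewrite /induced !inE xc eq_sym cy xA yA.
Qed.

(** A simple path from [c] never returns to [c], so all but its first edge survives the deletion. *)
Lemma connect_setD1 (G : sgraph) (A : {set G}) c x :
  connect (induced A) c x -> x != c ->
  exists2 a, induced A c a & connect (induced (A :\ c)) a x.
Proof.
move=> /connectP[p cp ->]; case/shortenP: cp => -[|a q] /=; first by rewrite eqxx.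
move=> /andP[ca aq] /andP[]; rewrite inE negb_or => /andP[ca' cq] _ _ _.
exists a => //; apply/connectP; exists q => //.
by apply: path_induced_setD1 => //; rewrite eq_sym.
Qed.

(* Removing [c] leaves fewer than [n] components with an edge, or else [c] is
   the centre of a spider; in each of them the paths starting at a neighbour
   of [c] are shorter. *)
Lemma vc_bound_rooted (G : sgraph) n L (A : {set G}) c :
  ~ has_spider G n -> c \in A ->
  (forall x, x \in A -> connect (induced A) c x) ->
  (forall p, path (induced A) c p -> uniq (c :: p) -> size p <= L) ->
  exists S : {set G}, [/\ S \subset A, #|S| <= iter L (fun m => (n * m).+1) 0 &
    forall x y, induced A x y -> (x \in S) || (y \in S)].
Proof.
move=> nosp; elim: L A c => [|L IH] A c cA conn len.
  have Ac x : x \in A -> x = c.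
    move=> /conn cx; apply/eqP; apply/negPn/negP => /(connect_setD1 cx)[a ca _].
    have ca' : c != a.
      by apply: contraTneq ca => <-; rewrite /induced sadj_irr !andbF.
    by have := len [:: a]; rewrite /= ca inE ca' => /(_ isT isT).
  exists set0; rewrite sub0set cards0; split=> // x y /and3P[xA yA].
  by rewrite (Ac x xA) (Ac y yA) sadj_irr.
pose A' := A :\ c; pose e' := induced A'.
have e'sym : connect_sym e' by apply/sym_connect_sym/induced_sym.
(* Neighbours of [c] isolated in [A'] are left out: their only edge in [A] goes to [c], which the
   cover contains. *)
pose N := [set a in A' | sadj G c a && [exists b, e' a b]].
pose R := [set root e' a | a in N].
have cardR : #|R| <= n.
  rewrite leqNgt; apply/negP => /ltnW nR; case: nosp.
  have /fin_all_exists[a /fin_all_exists[b abP]] (i : 'I_n) : exists a b,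
      [/\ sadj G c a, e' a b & root e' a = enum_val (widen_ord nR i)].
    have /imsetP[a aN ->] := enum_valP (widen_ord nR i).
    by move: aN; rewrite inE => /and3P[_ ca /existsP[b ab]]; exists a, b.
  exists c, a, b; split=> [i|i|i j z].
  - by have [] := abP i.
  - by have [_ /and3P[]] := abP i.
  have rz (k : 'I_n) : z \in [:: a k; b k] -> root e' z = enum_val (widen_ord nR k).
    have [_ abk <-] := abP k; rewrite !inE => /orP[] /eqP-> //.
    by apply/esym/(rootP e'sym)/connect1.
  by move=> /rz zi /rz; rewrite zi => /enum_val_inj/(congr1 val)/= /val_inj.
have /fin_all_exists[F FP] r : exists S : {set G}, r \in R ->
    [/\ S \subset A', #|S| <= iter L (fun m => (n * m).+1) 0 &
        forall x y, e' x y -> root e' x = r -> (x \in S) || (y \in S)].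
  have [/imsetP[a aN ->]|//] := boolP (r \in R); last by exists set0.
  move: aN; rewrite inE => /and3P[aA' ca _].
  pose D := [set x in A' | connect e' a x].
  have De' : subrel (induced D) e'.
    move=> x y /and3P[]; rewrite !inE => /andP[xA _] /andP[yA _] xy.
    by apply/and3P; rewrite !inE.
  have pathD x p : connect e' a x -> path e' x p -> path (induced D) x p.
    elim: p x => [|y p IHp] x //= ax /andP[xy yp].
    have ay := connect_trans ax (connect1 xy); rewrite IHp // andbT.
    by move: xy => /and3P[xA yA xy]; apply/and3P; split; rewrite // inE ?xA ?yA.
  have [||p ap up|S [SD cS cov]] := IH D a.
  - by rewrite inE aA' connect0.
  - move=> x; rewrite inE => /andP[_ /connectP[p ap ->]].
    by apply/connectP; exists p => //; apply: pathD.
  - have {}ap := sub_path De' ap.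
    have pA' := path_induced_sub aA' ap.
    (* Prepending [c] lengthens the path by one edge, which turns the bound [L.+1] at [c] into [L]
       at [a]. *)
    apply: (len (a :: p)); last first.
      by rewrite /= -/(uniq (a :: p)) up andbT; apply/negP => /pA'; rewrite !inE eqxx.
    rewrite /= /induced cA ca; move: aA'; rewrite !inE => /andP[_ ->] /=.
    apply: sub_path ap => x y /and3P[]; rewrite !inE => /andP[_ xA] /andP[_ yA] xy.
    by apply/and3P.
  exists S => _; split=> //.
    by apply: subset_trans SD _; apply/subsetP => x; rewrite inE => /andP[].
  move=> x y xy /esym/(rootP e'sym) ax; apply: cov.
  by have := pathD x [:: y] ax; rewrite /= xy => /(_ isT)/andP[].
exists (c |: \bigcup_(r in R) F r); split.
- rewrite subUset sub1set cA; apply/bigcupsP => r /FP[FA' _ _].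
  by apply: subset_trans FA' (subD1set _ _).
- rewrite iterS cardsU1 -add1n leq_add ?leq_b1 //.
  apply: leq_trans (_ : #|R| * iter L (fun m => (n * m).+1) 0 <= _); last first.
    by rewrite leq_mul2r cardR orbT.
  by apply: card_bigcup_le => r /FP[].
move=> x y /and3P[xA yA xy]; rewrite !in_setU1.
have [->//|xc] := eqVneq x c; have [->|yc] := eqVneq y c; first by rewrite orbT.
have e'xy : e' x y by apply/and3P; rewrite !inE xc yc.
have [a /and3P[_ aA ca] ax] := connect_setD1 (conn x xA) xc.
have aA' : a \in A'.
  by rewrite !inE aA andbT; apply: contraTneq ca => ->; rewrite sadj_irr.
have aN : a \in N.
  rewrite inE aA' ca /=; apply/existsP.
  case/connectP: ax => -[|b p] /= => [_ <-|/andP[ab _] _]; first by exists y.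
  by exists b.
have rR : root e' a \in R by apply: imset_f.
have [_ _ /(_ x y e'xy)] := FP _ rR.
rewrite -[root e' x](rootP e'sym ax) => /(_ erefl) /= /orP[xF|yF].
  by rewrite (_ : x \in _) //; apply/bigcupP; exists (root e' a).
by rewrite (_ : y \in _) ?orbT //; apply/bigcupP; exists (root e' a).
Qed.

Lemma compvc_bound (G : sgraph) n L :
  ~ has_spider G n -> no_path G L ->
  compvc_le G (iter L (fun m => (n * m).+1) 0).
Proof.
move=> nosp nop v; pose A := [set u | connect (sadj G) v u].
have pathA x p : connect (sadj G) v x -> path (sadj G) x p -> path (induced A) x p.
  elim: p x => [|y p IHp] x //= vx /andP[xy yp].
  have vy := connect_trans vx (connect1 xy); rewrite IHp // andbT.
  by apply/and3P; rewrite !inE.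
have [||p vp up|S [SA cS cov]] := @vc_bound_rooted G n L A v nosp.
- by rewrite inE connect0.
- by move=> x; rewrite inE => /connectP[p vp ->]; apply/connectP; exists p => //; apply: pathA.
- apply: ltnW; apply: ltnW; apply: (nop (v :: p)) => //=.
  by apply: sub_path vp => x y /and3P[].
by exists S; split=> // x y vx vy xy; apply: cov; apply/and3P; rewrite !inE.
Qed.

(** * Upper bounds for the product of two graphs *)

Lemma pw_dprod_compsize (G1 G2 : sgraph) k w :
  compsize_le G1 k -> pw_le G2 w -> pw_le (gdprod G1 G2) (k * w.+1).
Proof.
move=> comp /pw_interval_rep[l [r [lr edge width]]].
apply: (@pw_le_fibers (gdprod G1 G2) G1 (fun p => root (sadj G1) p.1)) => [x y|c].
  by move=> /andP[xy _]; apply/(rootP (@sadj_connect_sym _))/connect1.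
exists (fun p => l p.2), (fun p => r p.2); split=> [v _|x y _ _ /andP[_ /edge]|t] //.
apply/leqW; apply: leq_trans (leq_mul (comp c) (width t)).
rewrite -cardsX; apply/subset_leq_card/subsetP => -[a v].
rewrite !inE /= => /andP[/eqP <- ->]; rewrite andbT.
by rewrite (@sadj_connect_sym G1) connect_root.
Qed.

Lemma pw_dprod_compvc (G1 G2 : sgraph) k d w :
  compvc_le G1 k -> maxdeg_le G2 d -> pw_le G2 w ->
  pw_le (gdprod G1 G2) (k * (w.+1 * d.+1)).
Proof.
move=> vc deg /pw_interval_rep[l [r [lr edge width]]].
pose H := gdprod G1 G2; pose P := #|H|.
pose near (v : G2) := [pred u | (u == v) || sadj G2 v u].
have near_edge u v : u \in near v -> l u <= r v /\ l v <= r u.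
  rewrite inE => /predU1P[->|vu]; first by rewrite lr.
  by split; apply: edge; rewrite // sadj_sym.
(* The span of the intervals of the closed neighbours of [v]. It has no gaps, because all of them
   meet the interval of [v]. *)
pose l' v := l [arg min_(u < v | u \in near v) l u].
pose r' v := r [arg max_(u > v | u \in near v) r u].
have near_refl v : v \in near v by rewrite inE eqxx.
have l'P v u : u \in near v -> l' v <= l u.
  by rewrite /l'; case: arg_minnP => [|m _ +]; [exact: near_refl|exact].
have r'P v u : u \in near v -> r u <= r' v.
  by rewrite /r'; case: arg_maxnP => [|m _ +]; [exact: near_refl|exact].
have width' i : #|[set v | l' v <= i <= r' v]| <= w.+1 * d.+1.
  apply: leq_trans (_ : #|cnbhd [set v | l v <= i <= r v]| <= _); last first.
    by apply: leq_trans (card_cnbhd _ deg) _; rewrite leq_mul2r width orbT.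
  apply/subset_leq_card/subsetP => v; rewrite !inE => /andP[li ir].
  have nearv u : u \in near v -> (u == v) || sadj G2 u v by rewrite inE sadj_sym.
  apply/exists_inP; move: li ir; rewrite /l' /r'.
  case: arg_minnP => [|m mv _ li]; first exact: near_refl.
  case: arg_maxnP => [|M Mv _ ir]; first exact: near_refl.
  have [Lm mL] := near_edge _ _ mv; have [LM ML] := near_edge _ _ Mv.
  have [iv|vi] := ltnP i (l v).
    by exists m; rewrite ?nearv // inE li; apply: ltnW (leq_trans iv _).
  have [iv|{}iv] := leqP i (r v); first by exists v; rewrite ?eqxx // inE vi.
  by exists M; rewrite ?nearv // inE ir andbT; apply: leq_trans (ltnW iv).
apply: (@pw_le_fibers H G1 (fun p => root (sadj G1) p.1)) => [x y|c].
  by move=> /andP[xy _]; apply/(rootP (@sadj_connect_sym _))/connect1.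
have [S [_ cS cov]] := vc c.
have rk (x : H) : enum_rank x < P by apply: ltn_ord.
(* Each time of [G2] becomes a block of [P] moments. Vertices over [S] fill whole blocks; any other
   vertex lives for one moment, at its own rank in block [l x.2], while all its neighbours are
   alive. *)
pose lo (x : H) := if x.1 \in S then l' x.2 * P else l x.2 * P + enum_rank x.
pose hi (x : H) := if x.1 \in S then r' x.2 * P + P.-1 else l x.2 * P + enum_rank x.
exists lo, hi; split=> [[a v] _|[a v] [b u] /= ac bc /andP[/= ab vu]|t].
- rewrite /lo /hi /=; case: ifP => // _.
  apply: leq_trans (leq_addr _ _); rewrite leq_mul2r.
  by rewrite (leq_trans (l'P v v _)) ?orbT // (leq_trans (lr v)) ?r'P.
- have connc z : root (sadj G1) z = c -> connect (sadj G1) c z.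
    by move=> <-; rewrite (@sadj_connect_sym G1) connect_root.
  have := cov _ _ (connc _ ac) (connc _ bc) ab.
  have uv : u \in near v by rewrite inE vu orbT.
  have vu' : v \in near u by rewrite inE sadj_sym vu orbT.
  have := l'P v v (near_refl v); have := r'P u u (near_refl u).
  have := edge _ _ vu; have := l'P _ _ uv; have := r'P _ _ vu'; have := lr v.
  have := rk (a, v); have := rk (b, u); rewrite /lo /hi /=.
  by case: ifP => _; case: ifP => _ //=; nia.
(* At moment [t] the block is [t %/ P], and only the vertex of rank [t %% P] can be alive outside
   [S]. *)
apply: leq_trans (_ : #|setX S [set v | l' v <= t %/ P <= r' v]
   :|: [set x : H | enum_rank x == t %% P :> nat]| <= _).
  apply/subset_leq_card/subsetP => -[a v]; rewrite !inE /= => /andP[_].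
  have rav := rk (a, v); have P0 : 0 < P by apply: leq_trans rav.
  rewrite /lo /hi /=; case: ifP => aS /andP[lt tr].
    rewrite leq_divRL // lt -ltnS ltn_divLR // mulSn; apply/orP; left.
    by move: tr; rewrite /=; lia.
  have -> : t = l v * P + enum_rank (a, v) by apply/eqP; rewrite eqn_leq tr lt.
  by rewrite modnMDl modn_small ?eqxx.
apply: leq_trans (leq_card_setU _ _) _; rewrite -addn1; apply: leq_add.
  by rewrite cardsX leq_mul.
have [P0|P0] := posnP P.
  by rewrite (leq_trans (max_card _)) // -/P P0.
rewrite -(cards1 (enum_val (Ordinal (ltn_pmod t P0)))).
apply/subset_leq_card/subsetP => x; rewrite !inE => /eqP xt.
by apply/eqP; rewrite -[x]enum_rankK; congr enum_val; apply: val_inj.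
Qed.

(** * From graphs to classes *)

Lemma bounded_dprod_swap (C1 C2 : sgraph -> Prop) :
  bounded pw_le (class_dprod C1 C2) -> bounded pw_le (class_dprod C2 C1).
Proof.
move=> [k pwk]; exists k => _ [G2 [G1 [C2G [C1G ->]]]].
by apply: gsub_pw_le (dprod_swap G1 G2) _; apply: pwk; exists G1, G2.
Qed.

Lemma bounded_dprod_left (C1 C2 : sgraph -> Prop) :
  C2 K2 -> bounded pw_le (class_dprod C1 C2) -> bounded pw_le C1.
Proof.
move=> K [k pwk]; exists k => G C1G; apply: pw_le_double_cover.
by apply: pwk; exists G, K2.
Qed.

Lemma bounded_dprod_compsize (C1 C2 : sgraph -> Prop) :
  bounded compsize_le C1 -> bounded pw_le C2 ->
  bounded pw_le (class_dprod C1 C2).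
Proof.
move=> [k ck] [w pw]; exists (k * w.+1) => _ [G1 [G2 [C1G [C2G ->]]]].
by apply: pw_dprod_compsize; [apply: ck|apply: pw].
Qed.

Lemma bounded_dprod_compvc (C1 C2 : sgraph -> Prop) :
  bounded compvc_le C1 -> bounded maxdeg_le C2 -> bounded pw_le C2 ->
  bounded pw_le (class_dprod C1 C2).
Proof.
move=> [k ck] [d deg] [w pw]; exists (k * (w.+1 * d.+1)) => _ [G1 [G2 [C1G [C2G ->]]]].
by apply: pw_dprod_compvc; [apply: ck|apply: deg|apply: pw].
Qed.

Definition avoids (P : sgraph -> nat -> Prop) (n : nat) (C : sgraph -> Prop) : Prop :=
  forall G, C G -> ~ P G n.

(** By excluded middle: a single graph of [C1] with [P] forbids [Q] in all of [C2]. *)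
Lemma exclusion_split (P Q : sgraph -> Prop) (C1 C2 : sgraph -> Prop) :
  (forall G1 G2, C1 G1 -> C2 G2 -> P G1 -> ~ Q G2) ->
  (forall G, C1 G -> ~ P G) \/ (forall G, C2 G -> ~ Q G).
Proof.
move=> PQ; have [|noP] := classic (exists2 G, C1 G & P G).
  by case=> G1 C1G PG; right=> G2 C2G; apply: PQ PG.
by left=> G C1G PG; apply: noP; exists G.
Qed.

Lemma bounded_dprod_dichotomy (C1 C2 : sgraph -> Prop) :
  bounded pw_le (class_dprod C1 C2) ->
  [\/ bounded compsize_le C1 \/ bounded compsize_le C2,
      bounded compvc_le C1 /\ bounded maxdeg_le C2
    | bounded compvc_le C2 /\ bounded maxdeg_le C1].
Proof.
(* [k.+2] is the least size exceeding the bag bound [k.+1] of the obstructions. *)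
move=> [k pwk]; pose n := k.+2.
have pw12 G1 G2 : C1 G1 -> C2 G2 -> pw_le (gdprod G1 G2) k.
  by move=> ? ?; apply: pwk; exists G1, G2.
have pw21 G1 G2 (h1 : C1 G1) (h2 : C2 G2) : pw_le (gdprod G2 G1) k.
  exact: gsub_pw_le (dprod_swap _ _) (pw12 _ _ h1 h2).
have absurd : ~ n <= k.+1 by rewrite ltnn.
have stars : avoids has_star n C1 \/ avoids has_star n C2.
  apply: (@exclusion_split (has_star^~ n) (has_star^~ n)) => G1 G2 h1 h2 s1 s2.
  exact/absurd/(star_star s1 s2)/pw12.
have paths : avoids has_path n.*2 C1 \/ avoids has_path n.*2 C2.
  apply: (@exclusion_split (has_path^~ n.*2) (has_path^~ n.*2)) => G1 G2 h1 h2 s1 s2.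
  exact/absurd/(path_path s1 s2)/pw12.
have spider_paths : avoids has_spider n C1 \/ avoids has_path n.*2 C2.
  apply: (@exclusion_split (has_spider^~ n) (has_path^~ n.*2)) => G1 G2 h1 h2 s1 s2.
  exact/absurd/(spider_path s1 s2)/pw12.
have path_spiders : avoids has_path n.*2 C1 \/ avoids has_spider n C2.
  apply: (@exclusion_split (has_path^~ n.*2) (has_spider^~ n)) => G1 G2 h1 h2 s1 s2.
  exact/absurd/(spider_path s2 s1)/pw21.
have deg C : avoids has_star n C -> bounded maxdeg_le C.
  by move=> nos; exists n => G /nos; apply: no_star_maxdeg.
have size C : avoids has_star n C -> avoids has_path n.*2 C -> bounded compsize_le C.
  move=> nos nop; exists (n.+1 ^ n.*2) => G CG.
  by apply: compsize_bound; [apply/no_star_maxdeg/nos|apply/no_has_path/nop].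
have vc C : avoids has_spider n C -> avoids has_path n.*2 C -> bounded compvc_le C.
  move=> nos nop; exists (iter n.*2 (fun m => (n * m).+1) 0) => G CG.
  by apply: compvc_bound; [apply: nos|apply/no_has_path/nop].
(* If one class avoids both stars and paths, its components are bounded. In the mixed cases the
   spider alternative gives either this or a bound on the vertex covers. *)
case: stars => star; case: paths => pth.
- by apply: Or31; left; apply: size.
- case: path_spiders => [p1|s2]; first by apply: Or31; left; apply: size.
  by apply: Or33; split; [apply: vc|apply: deg].
- case: spider_paths => [s1|p2]; last by apply: Or31; right; apply: size.
  by apply: Or32; split; [apply: vc|apply: deg].
by apply: Or31; right; apply: size.
Qed.

Theorem mainTheorem20 (C1 C2 : sgraph -> Prop) :
  graph_class C1 -> graph_class C2 -> monotone C1 -> monotone C2 ->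
  C1 K2 -> C2 K2 ->
  (bounded pw_le (class_dprod C1 C2) <->
   bounded pw_le C1 /\ bounded pw_le C2 /\
   [\/ bounded compsize_le C1 \/ bounded compsize_le C2,
       bounded compvc_le C1 /\ bounded maxdeg_le C2
     | bounded compvc_le C2 /\ bounded maxdeg_le C1]).
Proof.
move=> _ _ _ _ KC1 KC2; split=> [pw12|[pw1 [pw2 [[s1|s2]|[vc deg]|[vc deg]]]]].
- split; first exact: bounded_dprod_left KC2 pw12.
  split; first exact: bounded_dprod_left KC1 (bounded_dprod_swap pw12).
  exact: bounded_dprod_dichotomy.
- exact: bounded_dprod_compsize.
- by apply/bounded_dprod_swap/bounded_dprod_compsize.
- exact: bounded_dprod_compvc.
- by apply/bounded_dprod_swap/bounded_dprod_compvc.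
Qed.
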